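(* Let $1\le p<n$, let $F_1,\ldots,F_p\in\mathbb{Q}[X_1,\ldots,X_n]$ be a reduced regular sequence generating the ideal of definition of the affine variety $S=\{F_1=\cdots=F_p=0\}\subset\mathbb{C}^n$, and suppose that $S$ is smooth. Let $1\le i\le n-p$ and suppose that for generic $a\in\mathbb{C}^{(n-p-i+1)\times n}$ the polar variety $W_{\underline{K}^{n-p-i}(\underline{a})}(S)$ is not empty. Then for generic $a\in\mathbb{C}^{(n-p-i+1)\times n}$ the following holds for every point $x\in W_{\underline{K}^{n-p-i}(\underline{a})}(S)\cap S_{reg}$: $x$ does not belong to $\underline{\Delta}_i$ if and only if $\omega_i^{-1}(x)$ is a zero-dimensional variety; and if this is the case, the morphism of algebraic varieties $\omega_i:H_i\to W_{\underline{K}^{n-p-i}(\underline{a})}(S)$ is unramified at every point of $\omega_i^{-1}(x)$.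
   Context: ''For generic $a$'' means: for all $a$ in a suitable non-empty Zariski open subset of $\mathbb{C}^{(n-p-i+1)\times n}$ consisting of matrices of maximal rank. $J(F_1,\ldots,F_p)=[\partial F_k/\partial X_l]$ is the $p\times n$ Jacobian matrix. ''Reduced regular sequence'' means a regular sequence such that the ideals $(F_1,\ldots,F_k)$, $1\le k\le p$, are radical. $S_{reg}$ is the set of points of $S$ where $J(F_1,\ldots,F_p)$ has rank $p$; $S$ is smooth if $S=S_{reg}$. For a full-rank matrix $b\in\mathbb{C}^{(n-p-j+1)\times n}$, $1\le j\le n-p$, the $j$th classic polar variety $W_{\underline{K}(\underline{b})}(S)=W_{\underline{K}^{n-p-j}(\underline{b})}(S)$ is the Zariski closure of the set of points of $S_{reg}$ at which all $(n-j+1)$-minors of $\begin{bmatrix}J(F_1,\ldots,F_p)\\ b\end{bmatrix}$ vanish. For full-rank $a\in\mathbb{C}^{(n-p-i+1)\times n}$ and $i<n-p$ put $\underline{\Delta}_i:=\bigcap_{1\le h\le n-p-i+1}W_{\underline{K}(\underline{a}^{(i,h)})}(S)$, where $a^{(i,h)}$ is the $(n-p-i)\times n$ matrix obtained from $a$ by deleting row $h$. For $i=n-p$ put $\underline{\Delta}_{n-p}:=\emptyset$. For full-rank $a$, $$H_i:=\{(x,(\lambda:\vartheta))\in\mathbb{C}^n\times\mathbb{P}^{n-i}\mid x\in S_{reg},\ \lambda\in\mathbb{C}^p,\ \vartheta\in\mathbb{C}^{n-p-i+1},\ (\lambda,\vartheta)\neq0,\ J(F_1,\ldots,F_p)(x)^T\lambda^T+a^T\vartheta^T=0\},$$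 and $\omega_i:H_i\to\mathbb{C}^n$ is the canonical projection $(x,(\lambda:\vartheta))\mapsto x$; its image is $W_{\underline{K}^{n-p-i}(\underline{a})}(S)\cap S_{reg}$, so it is regarded as a morphism $H_i\to W_{\underline{K}^{n-p-i}(\underline{a})}(S)$. Here $\mathbb{P}^{n-i}$ is complex projective space and varieties are taken reduced. *)

(* Defs.v *)
(* The field of complex numbers is [complex R], with [R : realType]. *)
From mathcomp Require Import all_boot all_order all_algebra.
From mathcomp Require Import mpoly complex.
From mathcomp Require Import classical_sets reals.

Set Implicit Arguments.
Unset Strict Implicit.
Unset Printing Implicit Defensive.

Import GRing.Theory Num.Theory.

Local Open Scope classical_set_scope.
Local Open Scope ring_scope.

Section Ideals.
Variables (A : comNzRingType) (p : nat).
Implicit Types (F : 'I_p -> A).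

(* The ideal generated by the first [k] members of the family. *)
Definition ideal_of F (k : nat) : set A :=
  [set f | exists q : 'I_p -> A, f = \sum_(j < p | (j < k)%N) q j * F j].

Definition regular_sequence F : Prop :=
  ~ ideal_of F p 1 /\
  forall (k : 'I_p) (g : A), ideal_of F k (g * F k) -> ideal_of F k g.

Definition radical_ideal (I : set A) : Prop :=
  forall (f : A) (m : nat), I (f ^+ m) -> I f.

Definition reduced_regular_sequence F : Prop :=
  regular_sequence F /\
  forall k : nat, (1 <= k <= p)%N -> radical_ideal (ideal_of F k).

End Ideals.

(* A set with a Zariski topology (given by its closed sets), together with the
   relation "on the set U, the function phi is represented by one well-defined
   fraction of polynomials".  Varieties are subsets of such a space, with the
   induced topology and the reduced structure. *)
Record zspace (C : Type) := ZSpace {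
  zpoint :> Type;
  zclosed : set zpoint -> Prop;
  zfrac : set zpoint -> (zpoint -> C) -> Prop
}.

Section Varieties.
Variable C : fieldType.
Implicit Types (X Y : zspace C).

Definition zopen X (U : set X) : Prop := zclosed (~` U).

Definition zclosure X (A : set X) : set X :=
  \bigcap_(Z in [set Z : set X | zclosed Z /\ A `<=` Z]) Z.

Definition zirreducible X (A : set X) : Prop :=
  A !=set0 /\
  forall Z1 Z2 : set X, zclosed Z1 -> zclosed Z2 ->
    A `<=` Z1 `|` Z2 -> A `<=` Z1 \/ A `<=` Z2.

Definition irreducible_chain X (A : set X) (d : nat) : Prop :=
  exists Z : nat -> set X,
    (forall k, (k <= d)%N ->
       zirreducible (Z k) /\ exists2 B : set X, zclosed B & Z k = A `&` B) /\
    (forall k, (k < d)%N -> Z k `<` Z k.+1).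

(* Krull dimension, for the topology induced on [A]. *)
Definition has_dimension X (A : set X) (d : nat) : Prop :=
  irreducible_chain A d /\ ~ irreducible_chain A d.+1.

(* [phi] represents an element of the local ring of [A] at [z]; only its values
   on [A] near [z] matter. *)
Definition regular_at X (A : set X) (z : X) (phi : X -> C) : Prop :=
  exists U : set X, [/\ zopen U, U z & zfrac (U `&` A) phi].

(* Equality in the local ring of [A] at [z]. *)
Definition same_germ X (A : set X) (z : X) (phi psi : X -> C) : Prop :=
  exists U : set X, [/\ zopen U, U z & forall y, U y -> A y -> phi y = psi y].

Definition maximal_ideal X (A : set X) (z : X) (phi : X -> C) : Prop :=
  regular_at A z phi /\ phi z = 0.

(* The ideal of the local ring of [A] at [z] generated by the image of the
   maximal ideal of the local ring of [B] at [w z]. *)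
Definition extended_ideal X Y (A : set X) (B : set Y) (w : X -> Y) (z : X)
    (phi : X -> C) : Prop :=
  exists (k : nat) (psi : 'I_k -> X -> C) (u : 'I_k -> Y -> C),
    (forall j, regular_at A z (psi j) /\ maximal_ideal B (w z) (u j)) /\
    same_germ A z phi (fun y => \sum_(j < k) psi j y * u j (w y)).

(* The morphism [A -> B] induced by [w] is unramified at [z].  The condition
   on residue fields is void, since all of them equal the ground field. *)
Definition unramified_at X Y (A : set X) (B : set Y) (w : X -> Y) (z : X) :
    Prop :=
  forall phi : X -> C,
    maximal_ideal A z phi <-> extended_ideal A B w z phi.

Definition aff_closed n (Z : set 'rV[C]_n) : Prop :=
  exists E : set {mpoly C[n]}, Z = [set x | forall f, E f -> f.@[x 0] = 0].

Definition aff_frac n (U : set 'rV[C]_n) (phi : 'rV[C]_n -> C) : Prop :=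
  exists f g : {mpoly C[n]},
    forall x, U x -> g.@[x 0] != 0 /\ phi x = f.@[x 0] / g.@[x 0].

Definition affine_space (n : nat) : zspace C :=
  ZSpace (@aff_closed n) (@aff_frac n).

(* The projective space of dimension [N - 1], as the set of lines of C^N. *)
Definition proj (N : nat) : Type := {L : {vspace 'rV[C]_N} | \dim L == 1%N}.

Definition homog_coord N (L : proj N) (v : 'rV[C]_N) : Prop :=
  v \in sval L /\ v != 0.

Definition bieval n N (f : {mpoly {mpoly C[n]}[N]}) (x : 'rV[C]_n)
    (v : 'rV[C]_N) : C :=
  (map_mpoly (meval (x 0)) f).@[v 0].

Definition affproj_closed n N (Z : set ('rV[C]_n * proj N)) : Prop :=
  exists E : set {mpoly {mpoly C[n]}[N]},
    (forall f, E f -> exists d : nat, f \is d.-homog) /\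
    Z = [set z | forall f v, E f -> homog_coord z.2 v -> bieval f z.1 v = 0].

Definition affproj_frac n N (U : set ('rV[C]_n * proj N))
    (phi : 'rV[C]_n * proj N -> C) : Prop :=
  exists (d : nat) (f g : {mpoly {mpoly C[n]}[N]}),
    [/\ f \is d.-homog, g \is d.-homog &
        forall z v, U z -> homog_coord z.2 v ->
          bieval g z.1 v != 0 /\ phi z = bieval f z.1 v / bieval g z.1 v].

Definition affine_proj_space (n N : nat) : zspace C :=
  ZSpace (@affproj_closed n N) (@affproj_frac n N).

(* The space of matrices is identified with affine space through [mxvec]. *)
Definition for_generic m n (P : 'M[C]_(m, n) -> Prop) : Prop :=
  exists U : set (affine_space (m * n)),
    [/\ zopen U, U !=set0 &
        forall a : 'M[C]_(m, n), U (mxvec a) -> \rank a = minn m n /\ P a].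

Definition minors_vanish m n (k : nat) (M : 'M[C]_(m, n)) : Prop :=
  forall (f : 'I_k -> 'I_m) (g : 'I_k -> 'I_n),
    {homo f : r s / (r < s)%N} -> {homo g : r s / (r < s)%N} ->
    \det (mxsub f g M) = 0.

End Varieties.

Section PolarVarieties.
Variables (R : realType) (n p : nat) (F : 'I_p -> {mpoly rat[n]}).
Local Notation C := (complex R).

Definition cpoly (f : {mpoly rat[n]}) : {mpoly C[n]} := map_mpoly ratr f.

Definition zero_locus : set (affine_space C n) :=
  [set x : 'rV[C]_n | forall k, (cpoly (F k)).@[x 0] = 0].

Definition generates_ideal_of_definition : Prop :=
  forall f : {mpoly C[n]},
    (forall x : 'rV[C]_n, zero_locus x -> f.@[x 0] = 0) <->
    ideal_of (fun k => cpoly (F k)) p f.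

Definition jacobian (x : 'rV[C]_n) : 'M[C]_(p, n) :=
  \matrix_(k < p, l < n) (mderiv l (cpoly (F k))).@[x 0].

Definition regular_locus : set (affine_space C n) :=
  [set x : 'rV[C]_n | zero_locus x /\ \rank (jacobian x) = p].

(* With m = n - p - j + 1 rows in [b], this is the j-th classic polar variety;
   its minors have size p + m = n - j + 1. *)
Definition polar_variety m (b : 'M[C]_(m, n)) : set (affine_space C n) :=
  zclosure ([set x : 'rV[C]_n | regular_locus x /\
               minors_vanish (p + m) (col_mx (jacobian x) b)]
            : set (affine_space C n)).

Variable i : nat.

Definition Delta (a : 'M[C]_((n - p - i).+1, n)) : set (affine_space C n) :=
  if (i < n - p)%N then
    \bigcap_(h in [set: 'I_(n - p - i).+1])
      polar_variety (row' h a : 'M[C]_(n - p - i, n))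
  else set0.

(* Here p + (n - p - i + 1) = n - i + 1, so that the second factor of the
   ambient space is the projective space of dimension n - i. *)
Definition H_space : zspace C :=
  affine_proj_space C n (p + (n - p - i).+1).

Definition H_variety (a : 'M[C]_((n - p - i).+1, n)) : set H_space :=
  [set z : 'rV[C]_n * proj C (p + (n - p - i).+1) |
    regular_locus z.1 /\
    exists (lambda : 'rV[C]_p) (theta : 'rV[C]_(n - p - i).+1),
      [/\ row_mx lambda theta != 0,
          sval z.2 = <[row_mx lambda theta]>%VS &
          (jacobian z.1)^T *m lambda^T + a^T *m theta^T = 0]].

Definition omega (z : H_space) : affine_space C n := z.1.

Definition omega_fiber (a : 'M[C]_((n - p - i).+1, n)) (x : 'rV[C]_n) :
    set H_space :=
  [set z | H_variety a z /\ omega z = x].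

End PolarVarieties.

Arguments zero_locus R {n p} F.
Arguments regular_locus R {n p} F.
Arguments generates_ideal_of_definition R {n p} F.
Arguments polar_variety {R n p} F {m} b.
Arguments Delta {R n p} F i a.
Arguments H_variety {R n p} F i a.
Arguments omega {R n p i} z.
Arguments omega_fiber {R n p} F i a x.

(* Main.v *)
(** Since S is smooth, the polar variety of [b] is the closed set of the points
    [x] of S where [J(x); b] is not of full row rank.  The fibre of omega over
    [x] is the projectivized left kernel of [M(x) = [J(x); a]]; it is an
    irreducible linear space, so it is zero-dimensional iff it is a point, i.e.
    iff [M(x)] has corank one.  As [J(x)] has full rank, a vector spanning such
    a kernel has a nonzero entry in some coordinate [h] of [theta], and then
    deleting the row [h] of [a] preserves the rank: this is [x] not in Delta.
    Near a point of corank one, a cofactor vector gives polynomial homogeneous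
    coordinates of the kernel line, hence a local section of omega, and omega
    is a local isomorphism. *)
Require Import Defs.
From mathcomp Require Import all_boot all_order all_algebra.
From mathcomp Require Import mpoly complex.
From mathcomp Require Import classical_sets reals.
From mathcomp Require Import perm boolp.

Set Implicit Arguments.
Unset Strict Implicit.
Unset Printing Implicit Defensive.

Import GRing.Theory Num.Theory.

Local Open Scope classical_set_scope.
Local Open Scope ring_scope.

(** * Minors, rank and left kernels *)

Section LinearAlgebra.
Variable K : fieldType.

(** Sorting the values of [g] gives [s], and injectivity makes the sorted sequence strictly
    increasing. [minors_vanish] admits increasing index maps only, so a choice of columns has to be
    reordered in this way. *)
Lemma homo_reorder (k n : nat) (g : 'I_k -> 'I_n) :
  injective g -> exists s : 'S_k, {homo g \o s : i j / (i < j)%N}.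
Proof.
move=> g_inj; pose le := relpre (@nat_of_ord n) leq.
pose t := [tuple g i | i < k].
have /tuple_permP[s st] : perm_eq (sort_tuple le t) t by rewrite /= perm_sort.
exists s => i j ij.
have g0 : 'I_n by exact: g i.
have nthE (l : 'I_k) : nth g0 (sort le t) l = g (s l).
  have -> : sort le t = [tuple tnth t (s i) | i < k] by exact: st.
  by rewrite -tnth_nth !tnth_mktuple.
have le_tr : transitive le by move=> a b c; exact: leq_trans.
have le_tot : total le by move=> a b; exact: leq_total.
have : le (g (s i)) (g (s j)).
  rewrite -!nthE; apply: (sorted_leq_nth le_tr) => //.
  - exact: (sort_sorted le_tot).
  - by rewrite inE size_sort size_map size_enum_ord.
  - by rewrite inE size_sort size_map size_enum_ord.
  - exact: ltnW.
rewrite /le /= leq_eqVlt => /orP[/eqP/val_inj/g_inj/perm_inj ijE|//].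
by rewrite ijE ltnn in ij.
Qed.

Lemma mxrank_mxsub (m n k l : nat) (f : 'I_k -> 'I_m) (g : 'I_l -> 'I_n)
    (A : 'M[K]_(m, n)) : (\rank (mxsub f g A) <= \rank A)%N.
Proof.
rewrite mxsubrc (leq_trans (mxrankS (rowsub_sub _ _)))//.
rewrite -mxrank_tr trmx_mxsub -[X in (_ <= X)%N]mxrank_tr.
exact/mxrankS/rowsub_sub.
Qed.

(** At rank [k], some [k] independent columns, put in increasing order, give a nonzero minor;
    conversely a nonzero minor of size [k] forces rank [k]. *)
Lemma minors_vanishP (k n : nat) (A : 'M[K]_(k, n)) :
  minors_vanish k A <-> (\rank A < k)%N.
Proof.
split=> [A0|rA f g _ _].
  rewrite ltn_neqAle rank_leq_row andbT; apply/negP => rA.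
  have rAT : row_full A^T by rewrite /row_full mxrank_tr.
  have [s hs] := homo_reorder (@fullrankfun_inj _ _ _ _ rAT).
  have := A0 id (fullrankfun rAT \o s) (fun _ _ => id) hs.
  have -> : mxsub id (fullrankfun rAT \o s) A =
            (row_perm s (rowsub (fullrankfun rAT) A^T))^T.
    by apply/matrixP => i j; rewrite !mxE.
  rewrite det_tr row_permE => /eqP; apply/negP.
  by rewrite -unitfE -unitmxE unitmx_mul unitmx_perm fullrowsub_unit.
apply/eqP/negPn; rewrite -unitfE -unitmxE -row_free_unit; apply/negP => /eqP.
move=> r; move: rA; rewrite ltnNge => /negP; apply.
by rewrite -[X in (X <= _)%N]r mxrank_mxsub.
Qed.

Lemma rank_lt_rowP (k n : nat) (A : 'M[K]_(k, n)) :
  (\rank A < k)%N <-> exists2 v : 'rV_k, v != 0 & v *m A = 0.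
Proof.
split=> [rA|[v v0 vA]].
  have /rowV0Pn[v /sub_kermxP vA v0] : kermx A != 0.
    by rewrite kermx_eq0 /row_free neq_ltn rA.
  by exists v.
rewrite ltn_neqAle rank_leq_row andbT; apply: contra v0 => fA.
by rewrite -(mulmx_free_eq0 v fA) vA.
Qed.

(** [kermx A] has dimension [k - \rank A] and contains the line of [v], so the two coincide exactly
    when that dimension is one. *)
Lemma kermx_lineP (k n : nat) (A : 'M[K]_(k, n)) (v : 'rV_k) :
    v != 0 -> v *m A = 0 ->
  (\rank A).+1 = k <-> forall w : 'rV_k, w *m A = 0 -> (w <= v)%MS.
Proof.
move=> v0 vA; have rv : \rank v = 1%N by rewrite rank_rV v0.
have vk : (v <= kermx A)%MS by exact/sub_kermxP.
have rk := mxrank_ker A; have rle := rank_leq_row A.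
split=> [rA w /sub_kermxP wk|h].
  have rk1 : \rank (kermx A) = 1%N.
    by apply/eqP; rewrite rk -(eqn_add2r (\rank A)) subnK// add1n rA.
  apply: (submx_trans wk).
  by have [_ <-] := mxrank_leqif_sup vk; rewrite rv rk1.
have kv : (kermx A <= v)%MS.
  by apply/rV_subP => w /sub_kermxP; exact: h.
have := mxrankS kv; have := mxrankS vk; rewrite rv rk => h1 h2.
have /eqP h3 : (k - \rank A == 1)%N by rewrite eqn_leq h1 h2.
by rewrite -add1n -h3 subnK.
Qed.

End LinearAlgebra.

(** * Polynomial sections of the left kernel *)

(* A polynomial parametrization of the left kernel of a matrix [A] of corank
   one: a row of the adjugate of the square matrix [P A Q] annihilates [P A Q]
   as soon as the latter is singular. *)
Definition kernel_section (K : comNzRingType) (N n : nat) (P : 'M[K]_N)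
    (Q : 'M[K]_(n, N)) (r : 'I_N) (A : 'M[K]_(N, n)) : 'rV[K]_N :=
  row r (\adj (P *m A *m Q)) *m P.

Lemma map_kernel_section (K L : comNzRingType) (f : {rmorphism K -> L})
    (N n : nat) (P : 'M[K]_N) (Q : 'M[K]_(n, N)) (r : 'I_N)
    (A : 'M[K]_(N, n)) :
  map_mx f (kernel_section P Q r A) =
  kernel_section (map_mx f P) (map_mx f Q) r (map_mx f A).
Proof. by rewrite /kernel_section map_mxM map_row map_mx_adj !map_mxM. Qed.

Section KernelSection.
Variable K : fieldType.

Lemma kernel_section_neq0 (N n : nat) (A : 'M[K]_(N, n)) :
    (\rank A).+1 = N ->
  exists (P : 'M[K]_N) (Q : 'M[K]_(n, N)) (r : 'I_N),
    kernel_section P Q r A != 0.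
Proof.
case: N A => [//|N] A [rA].
pose P := invmx (col_ebase A).
(* With these factors [P *m A *m Q] is the diagonal matrix with [N] ones and a final zero, whose
   adjugate has a nonzero last diagonal entry. *)
exists P, (invmx (row_ebase A) *m pid_mx N), ord_max.
have PU : P \in unitmx by rewrite unitmx_inv col_ebase_unit.
have Nn : (N <= n)%N by rewrite -rA rank_leq_col.
rewrite /kernel_section.
have -> : P *m A *m (invmx (row_ebase A) *m pid_mx N) = pid_mx N.
  have -> : P *m A = pid_mx N *m row_ebase A.
    rewrite -[X in P *m X](mulmx_ebase A) rA -mulmxA.
    by rewrite mulKmx ?col_ebase_unit.
  by move=> k; rewrite mulmxA mulmxK ?row_ebase_unit// pid_mx_id.
apply/eqP => /(congr1 (mulmx^~ (invmx P))).
rewrite mulmxK // mul0mx => /rowP/(_ ord_max); rewrite !mxE /cofactor.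
have -> : row' ord_max (col' ord_max (pid_mx N)) = 1%:M :> 'M[K]_N.
  by apply/matrixP => i j; rewrite !mxE !lift_max ltn_ord andbT.
rewrite det1 mulr1 => /eqP; apply/negP.
by rewrite signr_eq0.
Qed.

(** The section kills [A *m Q], since [\adj B *m B] is [\det B] times the identity and [B] is
    singular. A nonzero adjugate entry forces [A *m Q] to have corank one, so its left kernel is the
    line of [v]. *)
Lemma kernel_sectionP (N n : nat) (P : 'M[K]_N) (Q : 'M[K]_(n, N)) (r : 'I_N)
    (A : 'M[K]_(N, n)) (v : 'rV[K]_N) :
    v != 0 -> v *m A = 0 -> kernel_section P Q r A != 0 ->
  exists2 c : K, c != 0 & kernel_section P Q r A = c *: v.
Proof.
move=> v0 vA s0; pose B := P *m A *m Q.
have rAQ : (\rank (A *m Q) < N)%N.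
  by apply/rank_lt_rowP; exists v; rewrite // mulmxA vA mul0mx.
have sAQ : kernel_section P Q r A *m (A *m Q) = 0.
  have dB : \det B = 0.
    apply/eqP/negPn; rewrite -unitfE -unitmxE -row_free_unit /B -mulmxA.
    apply/negP => /eqP rB; move: rAQ; rewrite ltnNge => /negP; apply.
    by rewrite -[X in (X <= _)%N]rB mxrankM_maxr.
  transitivity (row r (\adj B *m B)).
    by rewrite row_mul /kernel_section /B !mulmxA.
  by rewrite mul_adj_mx dB raddf0 linear0.
have [j Brj] : exists j, \adj B r j != 0.
  apply/existsP; apply: contraNT s0; rewrite negb_exists => /forallP Br0.
  rewrite /kernel_section (_ : row r _ = 0) ?mul0mx//.
  by apply/rowP => j; rewrite !mxE -/B; have := Br0 j; rewrite !mxE negbK => /eqP.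
have lineAQ : (\rank (A *m Q)).+1 = N.
  apply/eqP; rewrite eqn_leq rAQ /=.
  have := mxrankM_maxr P (A *m Q); rewrite mulmxA -/B.
  (* The nonzero adjugate entry is, up to sign, a minor of [B] of size [N.-1]. *)
  move: Brj; rewrite mxE /cofactor mulf_eq0 negb_or => /andP[_].
  rewrite -unitfE -unitmxE -row_free_unit => /eqP rB' rB.
  have : (N.-1 <= \rank (A *m Q))%N.
    apply: leq_trans rB; rewrite -[X in (X <= _)%N]rB' row'Esub col'Esub.
    by rewrite -mxsubrc mxrank_mxsub.
  by rewrite -ltnS prednK // (leq_ltn_trans _ (ltn_ord r)).
have /sub_rVP[c sE] : (kernel_section P Q r A <= v)%MS.
  have vAQ : v *m (A *m Q) = 0 by rewrite mulmxA vA mul0mx.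
  by have [/(_ lineAQ) line _] := kermx_lineP v0 vAQ; exact: line.
exists c => //; apply: contraNneq s0 => c0.
by rewrite sE c0 scale0r.
Qed.

End KernelSection.

(** * Evaluation in affine and projective coordinates *)

Section Evaluation.

Lemma rmorph_mmap (R S T : comNzRingType) (N : nat) (a : R -> S)
    (b : {rmorphism S -> T}) (h : 'I_N -> S) (f : {mpoly R[N]}) :
  b (mmap a h f) = mmap (b \o a) (b \o h) f.
Proof.
rewrite /mmap rmorph_sum; apply: eq_bigr => m _.
rewrite rmorphM /mmap1 rmorph_prod; congr (_ * _).
by apply: eq_bigr => j _; rewrite rmorphXn.
Qed.

Lemma eq_mmap (R S : nzRingType) (N : nat) (a a' : R -> S)
    (h h' : 'I_N -> S) (f : {mpoly R[N]}) :
  a =1 a' -> h =1 h' -> mmap a h f = mmap a' h' f.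
Proof.
by move=> aE hE; rewrite /mmap; apply: eq_bigr => m _; rewrite aE (mmap1_eq _ hE).
Qed.

Variable K : fieldType.
Implicit Types (n N : nat).

(** [bieval] becomes a single [mmap], the form in which [rmorph_mmap] compares evaluations. *)
Lemma bievalE n N (f : {mpoly {mpoly K[n]}[N]}) (x : 'rV[K]_n)
    (v : 'rV[K]_N) : bieval f x v = mmap (meval (x 0)) (v 0) f.
Proof.
rewrite /bieval /map_mpoly rmorph_mmap; apply: eq_mmap => [q|j] /=.
  by rewrite mevalC.
by rewrite mevalXU.
Qed.

Lemma bievalD n N (f g : {mpoly {mpoly K[n]}[N]}) x v :
  bieval (f + g) x v = bieval f x v + bieval g x v.
Proof. by rewrite /bieval !rmorphD. Qed.

Lemma bievalM n N (f g : {mpoly {mpoly K[n]}[N]}) x v :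
  bieval (f * g) x v = bieval f x v * bieval g x v.
Proof. by rewrite /bieval !rmorphM. Qed.

Lemma bievalC n N (f : {mpoly K[n]}) x (v : 'rV[K]_N) :
  bieval f%:MP x v = f.@[x 0].
Proof. by rewrite /bieval map_mpolyC mevalC. Qed.

Lemma bievalZ n N (f : {mpoly {mpoly K[n]}[N]}) (d : nat) x c v :
  f \is d.-homog -> bieval f x (c *: v) = c ^+ d * bieval f x v.
Proof.
move=> /dhomogP fd; rewrite !bievalE /mmap mulr_sumr !big_seq.
apply: eq_bigr => m /fd mE; rewrite [RHS]mulrCA; congr (_ * _).
rewrite /mmap1 -mE /= mdegE -prodrXr -big_split.
by apply: eq_bigr => j _; rewrite mxE exprMn.
Qed.

(** Substituting polynomial coordinates [c] turns [f] into a polynomial on affine space; this pulls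
    fractions back along a section of the projection. *)
Lemma meval_bieval n N (f : {mpoly {mpoly K[n]}[N]}) (x : 'rV[K]_n)
    (c : 'rV[{mpoly K[n]}]_N) :
  f.@[c 0].@[x 0] = bieval f x (map_mx (meval (x 0)) c).
Proof.
rewrite bievalE /meval [X in mmap _ _ X]/mmap -/(mmap _ _ _) rmorph_mmap.
by apply: eq_mmap => // j; rewrite /= mxE.
Qed.

(** The restriction of [f] over [x] to the line [v + t *: w], as a polynomial in the parameter
    [t]. *)
Definition bieval_line n N (f : {mpoly {mpoly K[n]}[N]}) (x : 'rV[K]_n)
    (v w : 'rV[K]_N) : {poly K} :=
  mmap (polyC \o meval (x 0)) (fun j => (v 0 j)%:P + 'X * (w 0 j)%:P) f.

Lemma horner_bieval_line n N (f : {mpoly {mpoly K[n]}[N]}) x v w t :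
  (bieval_line f x v w).[t] = bieval f x (v + t *: w).
Proof.
rewrite bievalE -[LHS]/(horner_eval t (bieval_line f x v w)) rmorph_mmap.
apply: eq_mmap => [q|j] /=; rewrite /horner_eval ?hornerC//.
by rewrite !(hornerE, mxE).
Qed.

End Evaluation.

(** * Zariski topology and local rings on affine times projective space *)

Section Topology.
Variable K : fieldType.
Implicit Types (n N : nat).

Lemma homog_coordE N (L : proj K N) (v : 'rV[K]_N) :
  homog_coord L v <-> v != 0 /\ sval L = <[v]>%VS.
Proof.
case: L => L /= L1; rewrite /homog_coord /=; split=> [[vL v0]|[v0 ->]].
  split=> //; apply/eqP; rewrite eq_sym eqEdim -memvE vL.
  by rewrite dim_vline v0 (eqP L1).
by rewrite memv_line.
Qed.

Lemma homog_coord_scale N (L : proj K N) (v w : 'rV[K]_N) :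
  homog_coord L v -> homog_coord L w -> exists2 c, c != 0 & w = c *: v.
Proof.
move=> /homog_coordE[v0 LE] [wL w0]; move: wL; rewrite LE => /vlineP[c wE].
by exists c => //; apply: contraNneq w0 => c0; rewrite wE c0 scale0r.
Qed.

Lemma homog_coordZ N (L : proj K N) (v : 'rV[K]_N) c :
  c != 0 -> homog_coord L v -> homog_coord L (c *: v).
Proof.
by move=> c0 [vL v0]; split; [exact: memvZ | rewrite scaler_eq0 negb_or c0].
Qed.

Lemma homog_coord_ex N (L : proj K N) : exists v, homog_coord L v.
Proof.
exists (vpick (sval L)); split; first exact: memv_pick.
by case: L => L L1 /=; rewrite vpick0 -dimv_eq0 (eqP L1).
Qed.

Lemma homog_coord_inj N (L M : proj K N) (v : 'rV[K]_N) :
  homog_coord L v -> homog_coord M v -> L = M.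
Proof.
by move=> /homog_coordE[_ LE] /homog_coordE[_ ME]; apply/val_inj; rewrite /= LE ME.
Qed.

Lemma proj_of_vec N (v : 'rV[K]_N) : v != 0 -> exists L, homog_coord L v.
Proof.
move=> v0; have L1 : \dim <[v]> == 1%N by rewrite dim_vline v0.
by exists (exist _ <[v]>%VS L1); apply/homog_coordE.
Qed.

Lemma dhomogC (A : comNzRingType) N (c : A) : c%:MP_[N] \is 0.-homog.
Proof.
by rewrite -[c%:MP]mulr1 mul_mpolyC; apply: dhomogZ; exact: dhomog1.
Qed.

Lemma aff_zopen_neq0 n (f : {mpoly K[n]}) :
  zopen ([set x : 'rV[K]_n | f.@[x 0] != 0] : set (affine_space K n)).
Proof.
exists [set f]; apply/seteqP; split=> [x /= /negP/negPn/eqP fx _ -> //|x /= E].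
by apply/negP/negPn/eqP/E.
Qed.

Lemma affproj_zclosedT n N : zclosed (setT : set (affine_proj_space K n N)).
Proof. by exists set0; split=> [f []|]; apply/seteqP; split=> [z _ f v []|]. Qed.

Lemma affproj_zopenT n N : zopen (setT : set (affine_proj_space K n N)).
Proof.
exists [set 1]; split=> [f ->|]; first by exists 0%N; exact: dhomog1.
apply/seteqP; split=> [z /= []//|z E] _.
have [v zv] := homog_coord_ex z.2.
by have /eqP := E 1 v erefl zv; rewrite -mpolyC1 bievalC meval1 oner_eq0.
Qed.

Lemma affproj_zopenI n N (U V : set (affine_proj_space K n N)) :
  zopen U -> zopen V -> zopen (U `&` V).
Proof.
move=> [E [Eh UE]] [G [Gh VG]].
exists [set h | exists f g, [/\ E f, G g & h = f * g]]; split.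
  move=> _ [f [g [/Eh[d fd] /Gh[e ge] ->]]].
  by exists (d + e)%N; exact: dhomogM.
rewrite setCI UE VG; apply/seteqP; split.
  move=> z [Ez|Gz] _ v [f [g [Ef Gg ->]]] zv; rewrite bievalM.
    by rewrite (Ez f v)// mul0r.
  by rewrite (Gz g v)// mulr0.
move=> z EGz; apply: contrapT => /not_orP[/existsNP[f /existsNP[v]] nE].
move=> /existsNP[g /existsNP[w nG]].
move: nE => /not_implyP[Ef /not_implyP[zv /eqP fv]].
move: nG => /not_implyP[Gg /not_implyP[zw /eqP gw]].
(* [f] and [g] are nonzero at possibly different coordinate vectors of [z]; homogeneity of [g]
   brings both to [v]. *)
have [c c0 wE] := homog_coord_scale zv zw.
have [d gd] := Gh g Gg.
have := EGz (f * g) v (ex_intro _ f (ex_intro _ g (And3 Ef Gg erefl))) zv.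
move/eqP; rewrite bievalM mulf_eq0 (negbTE fv) /= => gv.
by move: gw; rewrite wE (bievalZ _ _ _ gd) mulf_eq0 gv orbT.
Qed.

(** Equations on affine space are constants for the projective coordinates, hence homogeneous of
    degree 0. *)
Lemma affproj_zopen_preimage n N (U : set (affine_space K n)) :
  zopen U ->
  zopen ([set z | U z.1] : set (affine_proj_space K n N)).
Proof.
move=> [E UE]; exists [set f%:MP | f in E]; split.
  by move=> _ [f _ <-]; exists 0%N; exact: dhomogC.
apply/seteqP; split=> [z /= nUz _ v [f Ef <-] zv|z /= Ez Uz].
  have : (~` U) z.1 by [].
  by rewrite UE bievalC => /(_ f Ef).
have : ~ (~` U) z.1 by move=> /(_ Uz).
apply; rewrite UE => f Ef; have [v zv] := homog_coord_ex z.2.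
by rewrite -(bievalC _ _ v); apply: Ez => //; exists f.
Qed.

Lemma regular_at_frac n N (A : set (affine_proj_space K n N)) z d
    (f g : {mpoly {mpoly K[n]}[N]}) phi (U : set (affine_proj_space K n N)) :
    f \is d.-homog -> g \is d.-homog -> zopen U -> U z ->
    (forall y v, U y -> A y -> homog_coord y.2 v ->
       bieval g y.1 v != 0 /\ phi y = bieval f y.1 v / bieval g y.1 v) ->
  regular_at A z phi.
Proof.
move=> fd gd oU Uz fg; exists U; split=> //; exists d, f, g.
by split=> // y v [Uy Ay]; exact: fg.
Qed.

Lemma regular_at_germ n N (A : set (affine_proj_space K n N)) z phi psi :
  same_germ A z phi psi -> regular_at A z psi -> regular_at A z phi.
Proof.
move=> [U [oU Uz UE]] [V [oV Vz [d [f [g [fd gd fg]]]]]].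
apply: (regular_at_frac fd gd (affproj_zopenI oU oV)) => // y v [Uy Vy] Ay yv.
by rewrite UE//; exact: fg.
Qed.

Lemma regular_at_ext n N (A : set (affine_proj_space K n N)) z phi psi :
  phi =1 psi -> regular_at A z psi -> regular_at A z phi.
Proof.
move=> E; apply: regular_at_germ; exists setT; split=> //.
exact: affproj_zopenT.
Qed.

Lemma regular_at_cst n N (A : set (affine_proj_space K n N)) z (c : K) :
  regular_at A z (fun=> c).
Proof.
apply: (@regular_at_frac _ _ _ _ 0%N c%:MP%:MP 1%:MP _ setT) => //.
- exact: dhomogC.
- exact: dhomogC.
- exact: affproj_zopenT.
- by move=> y v _ _ _; rewrite !bievalC mevalC meval1 oner_eq0 divr1.
Qed.

Lemma regular_atD n N (A : set (affine_proj_space K n N)) z phi psi :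
  regular_at A z phi -> regular_at A z psi ->
  regular_at A z (fun y => phi y + psi y).
Proof.
move=> [U [oU Uz [d [f [g [fd gd fg]]]]]] [V [oV Vz [e [f' [g' [fe ge fg']]]]]].
have fgd : f * g' + f' * g \is (d + e).-homog.
  by apply: dhomogD; [exact: dhomogM | rewrite addnC; exact: dhomogM].
apply: (regular_at_frac fgd (dhomogM gd ge) (affproj_zopenI oU oV)) => //.
move=> y v [Uy Vy] Ay yv.
have [g0 ->] := fg y v (conj Uy Ay) yv.
have [g'0 ->] := fg' y v (conj Vy Ay) yv.
by rewrite bievalD !bievalM mulf_neq0// addf_div.
Qed.

Lemma regular_atM n N (A : set (affine_proj_space K n N)) z phi psi :
  regular_at A z phi -> regular_at A z psi ->
  regular_at A z (fun y => phi y * psi y).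
Proof.
move=> [U [oU Uz [d [f [g [fd gd fg]]]]]] [V [oV Vz [e [f' [g' [fe ge fg']]]]]].
apply: (regular_at_frac (dhomogM fd fe) (dhomogM gd ge)
                        (affproj_zopenI oU oV)) => //.
move=> y v [Uy Vy] Ay yv.
have [g0 ->] := fg y v (conj Uy Ay) yv.
have [g'0 ->] := fg' y v (conj Vy Ay) yv.
by rewrite !bievalM mulf_neq0// mulf_div.
Qed.

Lemma regular_at_sum n N (A : set (affine_proj_space K n N)) z (I : Type)
    (r : seq I) (phi : I -> affine_proj_space K n N -> K) :
  (forall j, regular_at A z (phi j)) ->
  regular_at A z (fun y => \sum_(j <- r) phi j y).
Proof.
move=> phi_reg; elim: r => [|j r IHr].
  apply: regular_at_ext (regular_at_cst A z 0) => y.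
  by rewrite big_nil.
apply: regular_at_ext (regular_atD (phi_reg j) IHr) => y.
by rewrite big_cons.
Qed.

Lemma regular_at_pullback n N (A : set (affine_proj_space K n N))
    (B : set (affine_space K n)) (z : affine_proj_space K n N) u :
  (forall y, A y -> B y.1) -> regular_at B z.1 u ->
  regular_at A z (fun y => u y.1).
Proof.
move=> AB [U [oU Uz [f [g fg]]]].
apply: (regular_at_frac (dhomogC N f) (dhomogC N g)
                        (affproj_zopen_preimage _ oU)) => //.
by move=> y v Uy Ay _; rewrite !bievalC; apply: fg; split=> //; exact: AB.
Qed.

(* A section of [A -> B] with nonzero polynomial homogeneous coordinates near
   [z.1] makes this morphism an isomorphism onto its image near [z]. *)
Lemma unramified_section n N (A : set (affine_proj_space K n N))
    (B : set (affine_space K n)) (c : 'rV[{mpoly K[n]}]_N)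
    (z : affine_proj_space K n N) :
    A z -> (forall y, A y -> B y.1) ->
    (forall y : affine_proj_space K n N, A y ->
       map_mx (meval (y.1 0)) c != 0 ->
       homog_coord y.2 (map_mx (meval (y.1 0)) c)) ->
    map_mx (meval (z.1 0)) c != 0 ->
  @unramified_at K _ _ A B fst z.
Proof.
move=> Az AB cA cz phi; split; last first.
  (* The extended ideal lies in the maximal ideal: pulled-back germs are regular and vanish at
     [z]. *)
  move=> [k [psi [u [psiu phiE]]]]; split.
    apply: (regular_at_germ phiE); apply: regular_at_sum => j.
    have [psi_reg [u_reg _]] := psiu j.
    by apply: regular_atM => //; exact: regular_at_pullback u_reg.
  have [U [_ Uz ->//]] := phiE.
  by rewrite big1// => j _; have [_ [_ ->]] := psiu j; rewrite mulr0.
move=> [[U [oU Uz [d [f [g [fd gd fg]]]]]] phiz].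
(* [u] is the fraction of [phi] with [c] substituted for the projective coordinates, so [phi]
   factors through the projection near [z]. *)
pose u (x : affine_space K n) := f.@[c 0].@[x 0] / g.@[c 0].@[x 0].
have phiE y : U y -> A y -> map_mx (meval (y.1 0)) c != 0 -> phi y = u y.1.
  move=> Uy Ay cy; have [_ ->] := fg y _ (conj Uy Ay) (cA y Ay cy).
  by rewrite /u !meval_bieval.
exists 1%N, (fun _ _ => 1), (fun _ => u); split.
  move=> _; split; first exact: regular_at_cst.
  split; last by rewrite -phiE.
  exists [set x : 'rV[K]_n | g.@[c 0].@[x 0] != 0]; split.
  - exact: aff_zopen_neq0.
  - rewrite /= meval_bieval.
    by have [] := fg z _ (conj Uz Az) (cA z Az cz).
  - by exists f.@[c 0], g.@[c 0] => x [].
(* A coordinate of [c] nonzero at [z.1] gives an open neighbourhood on which the section stays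
   nonzero. *)
have [j czj] : exists j, (c 0 j).@[z.1 0] != 0.
  apply/existsP; apply: contraNT cz; rewrite negb_exists => /forallP c0.
  by apply/eqP/rowP => j; rewrite !mxE; apply/eqP/negPn.
pose V : set (affine_space K n) := [set x : 'rV[K]_n | (c 0 j).@[x 0] != 0].
exists (U `&` [set y | V y.1]); split.
- apply: affproj_zopenI => //; apply: affproj_zopen_preimage.
  exact: aff_zopen_neq0.
- by [].
- move=> y [Uy Vy] Ay; rewrite big_ord1 mul1r; apply: phiE => //.
  by apply: contraNneq Vy => /rowP/(_ j); rewrite !mxE => ->.
Qed.

End Topology.

(** In characteristic zero the numerals below [size q] are distinct, and there are more of them than
    [q] can have roots. *)
Lemma poly_nonroot (K : numFieldType) (q : {poly K}) :
  q != 0 -> exists t : K, q.[t] != 0.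
Proof.
move=> q0; apply: contrapT => /forallNP qr.
pose s := [seq (k%:R : K) | k <- iota 0 (size q)].
have : (size s < size q)%N.
  apply: max_poly_roots => //.
    by apply/allP => t _; apply/eqP/eqP/negPn/negP; exact: qr.
  by rewrite map_inj_uniq ?iota_uniq// => k l /eqP; rewrite eqr_nat => /eqP.
by rewrite size_map size_iota ltnn.
Qed.

(** * Projectivized left kernels: irreducibility and dimension *)

Section LinearFiber.
Variables (K : numFieldType) (n N m : nat) (x : 'rV[K]_n) (M : 'M[K]_(N, m)).
Variable A : set (affine_proj_space K n N).
Hypothesis AE : forall z, A z <->
  z.1 = x /\ exists2 v, homog_coord z.2 v & v *m M = 0.

Lemma linear_fiber_coord z v : A z -> homog_coord z.2 v -> v *m M = 0.
Proof.
move=> /AE[_ [w zw wM]] zv; have [c _ ->] := homog_coord_scale zw zv.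
by rewrite -scalemxAl wM scaler0.
Qed.

Lemma linear_fiber_eq z z' v :
  A z -> A z' -> homog_coord z.2 v -> homog_coord z'.2 v -> z = z'.
Proof.
move=> /AE[zx _] /AE[zx' _] zv zv'; move: zx zx' (homog_coord_inj zv zv').
by case: z zv => z1 z2; case: z' zv' => z1' z2' /= _ _ -> -> ->.
Qed.

(** Join coordinate vectors of a point outside [Z1] and a point outside [Z2] by a line: all but
    finitely many vectors on it give points of [A] outside both. *)
Lemma linear_fiber_irreducible : A !=set0 -> zirreducible A.
Proof.
move=> A0; split=> // Z1 Z2 [E1 [E1h ->]] [E2 [E2h ->]] AZ.
apply: contrapT => /not_orP[/existsNP[z1 nZ1] /existsNP[z2 nZ2]].
move: nZ1 nZ2 => /not_implyP[Az1 /existsNP[f1 /existsNP[v1]]] + /not_implyP[Az2].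
move=> /not_implyP[Ef1 /not_implyP[zv1 /eqP fv1]].
move=> /existsNP[f2 /existsNP[v2 /not_implyP[Ef2 /not_implyP[zv2 /eqP fv2]]]].
have [z1x _] := (AE z1).1 Az1; have [z2x _] := (AE z2).1 Az2.
have [_ v10] := zv1; have /existsP[j v1j] : [exists j, v1 0 j != 0].
  apply: contraNT v10; rewrite negb_exists => /forallP v10.
  by apply/eqP/rowP => j; rewrite mxE; apply/eqP/negPn.
(* Along the line [v1 + t (v2 - v1)], [f1] is nonzero at [t = 0], [f2] at
   [t = 1], and the [j]-th coordinate at [t = 0]. *)
pose q1 := bieval_line f1 x v1 (v2 - v1).
pose q2 := bieval_line f2 x v1 (v2 - v1).
pose q3 : {poly K} := (v1 0 j)%:P + 'X * ((v2 - v1) 0 j)%:P.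
have q10 : q1 != 0.
  apply: contraNneq fv1 => q0.
  by have := horner_bieval_line f1 x v1 (v2 - v1) 0; rewrite -/q1 q0 horner0
     scale0r addr0 z1x => <-.
have q20 : q2 != 0.
  apply: contraNneq fv2 => q0.
  by have := horner_bieval_line f2 x v1 (v2 - v1) 1; rewrite -/q2 q0 horner0
     scale1r addrC subrK z2x => <-.
have q30 : q3 != 0.
  apply: contraNneq v1j => q0; have := congr1 (fun q => q.[0]) q0.
  by rewrite !(hornerE, mul0r, addr0) => ->.
have [t] := poly_nonroot (mulf_neq0 (mulf_neq0 q10 q20) q30).
rewrite !hornerM !mulf_eq0 !negb_or => /andP[/andP[q1t q2t] q3t].
pose v := v1 + t *: (v2 - v1).
have v0 : v != 0.
  apply: contraNneq q3t => v0; have := congr1 (fun w : 'rV_N => w 0 j) v0.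
  by rewrite /q3 /v !(hornerE, mxE) => ->.
have [L Lv] := proj_of_vec v0.
have AL : A (x, L).
  apply/AE; split=> //; exists v => //; rewrite mulmxDl -scalemxAl mulmxBl.
  by rewrite (linear_fiber_coord Az1 zv1) (linear_fiber_coord Az2 zv2) subr0
     scaler0 addr0.
move: q1t q2t; rewrite !horner_bieval_line -/v.
by case: (AZ _ AL) => /= Ez; [rewrite (Ez f1 v)//= eqxx
                             | rewrite (Ez f2 v)//= eqxx].
Qed.

(** A vector lies in the row space of [w] iff [cokermx w] kills it, which is a system of linear
    forms in the projective coordinates. *)
Lemma zclosed_line (w : 'rV[K]_N) :
  zclosed ([set z | forall v, homog_coord z.2 v -> (v <= w)%MS]
           : set (affine_proj_space K n N)).
Proof.
pose l j : {mpoly {mpoly K[n]}[N]} :=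
  \sum_(k < N) (cokermx w k j)%:MP%:MP * 'X_k.
have lE j y v : bieval (l j) y v = (v *m cokermx w) 0 j.
  rewrite /bieval /l [map_mpoly _ _]rmorph_sum rmorph_sum mxE; apply: eq_bigr => k _.
  rewrite -[LHS]/(bieval _ y v) bievalM bievalC mevalC mulrC.
  by rewrite /bieval map_mpolyX mevalXU.
exists [set l j | j in setT]; split.
  move=> _ [j _ <-]; exists 1%N; apply: rpred_sum => k _.
  by rewrite mul_mpolyC; apply: dhomogZ; rewrite dhomogX /= mdeg1.
apply/seteqP; split=> [z zw _ v [j _ <-] zv|z zl v zv].
  by have /submxP[D ->] := zw v zv; rewrite lE -mulmxA mulmx_coker mulmx0 mxE.
rewrite submxE; apply/eqP/rowP => j; rewrite [RHS]mxE -(lE j z.1 v).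
by apply: zl => //; exists j.
Qed.

(** In corank at least two, a point of [A] followed by [A] itself is a chain of length one; in
    corank one, [A] is a single point. *)
Lemma linear_fiber_dim0 : (\rank M < N)%N ->
  has_dimension A 0 <-> (\rank M).+1 = N.
Proof.
move=> /rank_lt_rowP[v v0 vM]; have [L Lv] := proj_of_vec v0.
have AL : A (x, L) by apply/AE; split=> //; exists v.
have irr1 z : @zirreducible K (affine_proj_space K n N) [set z].
  split=> [|Z1 Z2 _ _ zZ]; first by exists z.
  by case: (zZ z erefl) => Zz; [left|right] => _ ->.
split=> [[_ nchain]|line].
  apply/(kermx_lineP v0 vM) => w wM; apply: contrapT => wv.
  have w0 : w != 0 by apply: contra_notN wv => /eqP ->; exact: sub0mx.
  have [L' L'w] := proj_of_vec w0.
  have AL' : A (x, L') by apply/AE; split=> //; exists w.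
  apply: nchain.
  exists (fun k => if k is 0%N then [set (x, L)] else A); split.
    move=> [_|k _]; split.
    - exact: irr1.
    (* This closed set leaves the affine coordinate free; [A] fixes it to [x], so the intersection
       is one point. *)
    - eexists; first exact: (zclosed_line v).
      apply/seteqP; split=> [_ -> |z [Az zv]].
        split=> // v' Lv'; have [c _ ->] := homog_coord_scale Lv Lv'.
        exact: scalemx_sub.
      have [u zu] := homog_coord_ex z.2.
      have /sub_rVP[c uE] := zv u zu.
      have c0 : c != 0.
        by have [_] := zu; apply: contraNneq => c0; rewrite uE c0 scale0r.
      apply: (linear_fiber_eq Az AL zu); rewrite uE.
      exact: homog_coordZ.
    - by apply: linear_fiber_irreducible; exists (x, L).
    - by exists setT; [exact: affproj_zclosedT | rewrite setIT].
  move=> [|//] _; rewrite properEneq; split; last by move=> _ ->.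
  apply/eqP => AE'; have : [set (x, L)] (x, L') by rewrite AE'.
  move=> [LL]; apply: wv; move: L'w; rewrite LL => L'w.
  by have [c _ ->] := homog_coord_scale Lv L'w; exact: scalemx_sub.
have A1 z : A z -> z = (x, L).
  move=> Az; have [u zu] := homog_coord_ex z.2.
  have uM := linear_fiber_coord Az zu.
  have [/(_ line) /(_ u uM) /sub_rVP[c uE] _] := kermx_lineP v0 vM.
  have c0 : c != 0.
    by have [_] := zu; apply: contraNneq => c0; rewrite uE c0 scale0r.
  by apply: (linear_fiber_eq Az AL zu); rewrite uE; exact: homog_coordZ.
have AE1 : A = [set (x, L)].
  by apply/seteqP; split=> [z /A1 -> //|_ ->].
split.
  exists (fun=> A); split=> // k _; split; first by rewrite AE1; exact: irr1.
  by exists setT; [exact: affproj_zclosedT | rewrite setIT].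
move=> [Z [Zk /(_ 0%N isT) [Z01 nZ10]]].
apply: nZ10 => z Z1z.
have [[[z0 Z0z0] _] _] := Zk 0%N isT.
have [_ [B1 _ Z1E]] := Zk 1%N isT.
have Z1A y : Z 1%N y -> A y by rewrite Z1E => -[].
by rewrite (A1 z (Z1A z Z1z)) -(A1 z0 (Z1A z0 (Z01 z0 Z0z0))).
Qed.

End LinearFiber.

(** * Corank one and deletion of a row *)

Lemma corank1_row'P (K : fieldType) (n p m : nat) (J : 'M[K]_(p, n))
    (a : 'M[K]_(m.+1, n)) :
    \rank J = p -> (\rank (col_mx J a) < p + m.+1)%N ->
  (exists h : 'I_m.+1, ~ (\rank (col_mx J (row' h a)) < p + m)%N) <->
  (\rank (col_mx J a)).+1 = (p + m.+1)%N.
Proof.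
move=> rJ rJa; split=> [[h /negP]|line].
  (* Deleting a row cannot raise the rank, so [\rank (col_mx J a)] is at least [p + m], one less
     than the number of rows. *)
  rewrite -leqNgt => le_r; apply/eqP.
  rewrite eqn_leq rJa andTb; apply: (@leq_trans (p + m).+1).
    by rewrite addnS.
  rewrite ltnS (leq_trans le_r)// mxrankS// col_mx_sub -!addsmxE addsmxSl.
  by rewrite (submx_trans _ (addsmxSr _ _))// row'Esub rowsub_sub.
have [v v0 vM] := (rank_lt_rowP _).1 rJa.
move: vM; rewrite -(hsubmxK v) mul_row_col; set l := lsubmx v.
set t := rsubmx v => vM.
have /existsP[h th] : [exists h, t 0 h != 0].
  apply: contraNT v0; rewrite negb_exists => /forallP t0.
  have tE : t = 0 by apply/rowP => j; rewrite [RHS]mxE; apply/eqP/negPn.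
  have /eqP : l *m J = 0 by move: vM; rewrite tE mul0mx addr0.
  rewrite mulmx_free_eq0 /row_free ?rJ// => /eqP lE.
  by rewrite -(hsubmxK v) -/l -/t lE tE row_mx0.
exists h; apply/negP; rewrite -leqNgt.
(* Since [t 0 h] is invertible, the kernel relation expresses row [h] of [a] through [J] and the
   other rows of [a]; deleting it keeps the row space. *)
suff sub : (col_mx J a <= col_mx J (row' h a))%MS.
  by apply: leq_trans (mxrankS sub); rewrite -ltnS line addnS.
have Jsub : (J <= col_mx J (row' h a))%MS by rewrite -addsmxE addsmxSl.
have row'sub j : j != h -> (row j a <= col_mx J (row' h a))%MS.
  case: (unliftP h j) => [k -> _|->]; last by rewrite eqxx.
  rewrite -addsmxE (submx_trans _ (addsmxSr _ _))//.
  by rewrite (_ : row _ a = row k (row' h a)) ?row_sub// row'Esub row_rowsub.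
rewrite col_mx_sub Jsub /=; apply/row_subP => j.
have [->|] := eqVneq j h; last exact: row'sub.
have : (t 0 h *: row h a <= col_mx J (row' h a))%MS.
  move: vM; rewrite (mulmx_sum_row t) (bigD1 h)//= addrCA => /eqP.
  rewrite addr_eq0 => /eqP ->.
  rewrite eqmx_opp addmx_sub// ?mulmx_sub//.
  by apply: summx_sub => k kh; rewrite scalemx_sub ?row'sub.
by rewrite (eqmx_scale _ th).
Qed.

Lemma zclosure_id (C : fieldType) (X : zspace C) (A : set X) :
  zclosed A -> zclosure A = A.
Proof.
move=> cA; apply/seteqP; split=> [x xA|x Ax Z [_ AZ]]; last exact: AZ.
by apply: (xA A); split.
Qed.

(** * The polar variety, [Delta] and the morphism [omega] *)

Section PolarVariety.
Variables (R : realType) (n p : nat) (F : 'I_p -> {mpoly rat[n]}).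
Local Notation C := (complex R).

(** Over the polynomial ring its maximal minors are equations in [x], and its kernel section has
    polynomial coordinates. *)
Definition poly_matrix m (a : 'M[C]_(m, n)) : 'M[{mpoly C[n]}]_(p + m, n) :=
  col_mx (\matrix_(k < p, l < n) mderiv l (cpoly R (F k)))
         (map_mx (@mpolyC n C) a).

Lemma meval_poly_matrix m (a : 'M[C]_(m, n)) (x : 'rV[C]_n) :
  map_mx (meval (x 0)) (poly_matrix a) = col_mx (jacobian F x) a.
Proof.
rewrite map_col_mx; congr col_mx; apply/matrixP => k l; rewrite !mxE//.
exact: mevalC.
Qed.

Hypothesis smooth : zero_locus R F = regular_locus R F.

(** By smoothness the regular locus is the closed zero locus, and the minors are polynomials in [x],
    so taking the closure adds no point. *)
Lemma polar_varietyE m (b : 'M[C]_(m, n)) :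
  polar_variety F b =
  [set x | regular_locus R F x /\
           (\rank (col_mx (jacobian F x) b) < p + m)%N].
Proof.
rewrite /polar_variety zclosure_id.
  by apply/seteqP; split=> x [xr /minors_vanishP].
exists [set q | (exists k, q = cpoly R (F k)) \/
  exists (f : 'I_(p + m) -> 'I_(p + m)) (g : 'I_(p + m) -> 'I_n),
  [/\ {homo f : r s / (r < s)%N}, {homo g : r s / (r < s)%N} &
    q = \det (mxsub f g (poly_matrix b) : 'M_(p + m))]].
rewrite -smooth; apply/seteqP; split=> x.
  move=> [xF xb] q [[k ->]|[f [g [fh gh ->]]]]; first exact: xF.
  by rewrite -det_map_mx map_mxsub meval_poly_matrix; exact: xb.
move=> xE; split=> [k|f g fh gh]; first by apply: xE; left; exists k.
rewrite -meval_poly_matrix -map_mxsub det_map_mx.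
by apply: xE; right; exists f, g.
Qed.

Variable i : nat.
Variable a : 'M[C]_((n - p - i).+1, n).

Lemma notin_DeltaP (x : 'rV[C]_n) : polar_variety F a x ->
  ~ Delta F i a x <->
  (\rank (col_mx (jacobian F x) a)).+1 = (p + (n - p - i).+1)%N.
Proof.
rewrite polar_varietyE => -[xr xa]; have [_ rJ] := xr.
rewrite /Delta; have [ilt|ige] := ltnP i (n - p).
  apply: iff_trans (corank1_row'P rJ xa); split=> [nD|[h nh] D].
    apply: contrapT => /forallNP nh; apply: nD => h _.
    by rewrite polar_varietyE; split=> //; exact: contrapT (nh h).
  by apply: nh; have := D h I; rewrite polar_varietyE => -[].
(* Here [Delta] is empty and [n - p - i] is 0, so [a] has a single row; the rank [p] of the Jacobian
   already forces corank one. *)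
split=> [_|_ []]; apply/eqP; rewrite eqn_leq xa /=.
have le_p : (p <= \rank (col_mx (jacobian F x) a))%N.
  by rewrite -[X in (X <= _)%N]rJ mxrankS// -addsmxE addsmxSl.
apply: leq_trans (_ : p.+1 <= _)%N; last by rewrite ltnS.
by rewrite addnS ltnS (eqP (_ : n - p - i == 0)%N) ?addn0// subn_eq0.
Qed.

(** Transposing the defining equation turns it into a left kernel condition on
    [row_mx lambda theta]. *)
Lemma H_varietyP (z : H_space R n p i) :
  H_variety F i a z <->
  regular_locus R F z.1 /\
  exists2 v, homog_coord z.2 v & v *m col_mx (jacobian F z.1) a = 0.
Proof.
have trE (l : 'rV[C]_p) (t : 'rV[C]_(n - p - i).+1) :
    (jacobian F z.1)^T *m l^T + a^T *m t^T =
    (row_mx l t *m col_mx (jacobian F z.1) a)^T.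
  by rewrite mul_row_col linearD /= !trmx_mul.
split=> -[zr].
  move=> [l [t [lt0 zE]]]; rewrite trE => /(congr1 trmx); rewrite trmxK trmx0.
  by move=> ltM; split=> //; exists (row_mx l t) => //; apply/homog_coordE.
move=> [v /homog_coordE[v0 zE] vM]; split=> //.
exists (lsubmx v), (rsubmx v).
by rewrite trE hsubmxK vM trmx0.
Qed.

(** The form required by the hypothesis [AE] on linear fibres. *)
Lemma omega_fiberP (x : 'rV[C]_n) : regular_locus R F x ->
  forall z : H_space R n p i, omega_fiber F i a x z <->
  z.1 = x /\ exists2 v, homog_coord z.2 v &
                        v *m col_mx (jacobian F x) a = 0.
Proof.
move=> xr z; rewrite /omega_fiber /omega /=; split.
  by move=> [/H_varietyP[_ zv] <-].
by move=> [zx zv]; split=> //; apply/H_varietyP; rewrite zx.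
Qed.

Lemma H_variety_polar (z : H_space R n p i) :
  H_variety F i a z -> polar_variety F a z.1.
Proof.
move=> /H_varietyP[zr [v [_ v0] vM]]; rewrite polar_varietyE; split=> //.
by apply/rank_lt_rowP; exists v.
Qed.

(** The data [P], [Q], [r] found at [z] stay constant as the point varies; wherever the resulting
    section [c] is nonzero at a point of [H_variety], it is a multiple of the kernel vector
    there. *)
Lemma omega_unramified (z : H_space R n p i) :
    H_variety F i a z ->
    (\rank (col_mx (jacobian F z.1) a)).+1 = (p + (n - p - i).+1)%N ->
  unramified_at (H_variety F i a) (polar_variety F a) omega z.
Proof.
move=> zH /kernel_section_neq0[P [Q [r]]].
pose c := kernel_section (map_mx (@mpolyC n C) P) (map_mx (@mpolyC n C) Q) r
  (poly_matrix a).
have mapK k l (B : 'M[C]_(k, l)) (x : 'rV[C]_n) :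
    map_mx (meval (x 0)) (map_mx (@mpolyC n C) B) = B.
  by apply/matrixP => s t; rewrite !mxE mevalC.
have cE (x : 'rV[C]_n) : map_mx (meval (x 0)) c =
    kernel_section P Q r (col_mx (jacobian F x) a).
  by rewrite map_kernel_section !mapK meval_poly_matrix.
rewrite -cE => cz; apply: unramified_section cz => //.
  exact: H_variety_polar.
move=> y /H_varietyP[_ [v yv vM]]; rewrite cE => c0.
have [v0 _] := (homog_coordE _ _).1 yv.
by have [e e0 ->] := kernel_sectionP v0 vM c0; exact: homog_coordZ.
Qed.

End PolarVariety.

Theorem proposition10 (R : realType) (n p i : nat)
    (F : 'I_p -> {mpoly rat[n]})
    (hp : (1 <= p < n)%N)
    (hF : reduced_regular_sequence F)
    (hS : generates_ideal_of_definition R F)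
    (hsmooth : zero_locus R F = regular_locus R F)
    (hi : (1 <= i <= n - p)%N)
    (hW : for_generic (fun a : 'M[complex R]_((n - p - i).+1, n) =>
            polar_variety F a !=set0)) :
  for_generic (fun a : 'M[complex R]_((n - p - i).+1, n) =>
    forall x : 'rV[complex R]_n,
      (polar_variety F a `&` regular_locus R F) x ->
      (~ Delta F i a x <-> has_dimension (omega_fiber F i a x) 0) /\
      (~ Delta F i a x ->
         forall z, omega_fiber F i a x z ->
           unramified_at (H_variety F i a) (polar_variety F a) omega z)).
Proof.
(* The nonempty open set given by [hW] serves again: its matrices have maximal rank, and the claims
   are checked at each of them. *)
have [U [oU U0 Ua]] := hW.
exists U; split=> // a /Ua[ra _]; split=> // x [xW xr].
have DeltaP := notin_DeltaP hsmooth xW.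
have xa : (\rank (col_mx (jacobian F x) a) < p + (n - p - i).+1)%N.
  by move: xW; rewrite polar_varietyE// => -[].
split=> [|nD z zx].
  apply: (iff_trans DeltaP); apply: iff_sym.
  exact: linear_fiber_dim0 (omega_fiberP a xr) xa.
have [zH zE] := zx; apply: omega_unramified => //.
by move: zE; rewrite /omega => ->; apply/DeltaP.
Qed.
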